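(* Let $n\geq 1$ be an integer, let $\Delta_n:=\{(i,j)\in\mathbb{Z}\times\mathbb{Z}\mid 0\leq i,\ 0\leq j,\ i+j\leq n\}$, and let $\Gamma\colon\Delta_n\to\mathbb{R}$ be a symmetric function such that $\Gamma(i,j)=1$ whenever $i\cdot j=0$, $$\Gamma(i+j,k)\,\Gamma(i,j)=\Gamma(i,j+k)\,\Gamma(j,k)\qquad\text{for all integers } i,j,k\geq 0 \text{ with } i+j+k\leq n,$$ and, for all $k\in\{2,\dots,n\}$, there exists $i\in\{1,\dots,k-1\}$ such that $\Gamma(i,k-i)\neq 0$. Assume that $d_0=\mathrm{id}\colon\mathbb{R}\to\mathbb{R}$ and that $d_1,\dots,d_n\colon\mathbb{R}\to\mathbb{R}$ are additive functions satisfying $$d_k(xy)=\sum_{i=0}^{k}\Gamma(i,k-i)\,d_i(x)\,d_{k-i}(y)\qquad(x,y\in\mathbb{R})$$ for all $k\in\{1,\dots,n\}$. Then the following statements are equivalent: (i) There exist $c_0,c_1,\dots,c_n\in\mathbb{R}$ such that $c_0^2+c_1^2+\cdots+c_n^2>0$ and $c_0x+c_1d_1(x)+\cdots+c_nd_n(x)=0$ for all $x\in\mathbb{R}$; (ii) There exists an upper semicontinuous function $\Phi\colon\mathbb{R}^{n+1}\to\mathbb{R}$ which is not nonnegative everywhere (i.e. $\Phi(p)<0$ for some $p\in\mathbb{R}^{n+1}$) and such that $\Phi(x,d_1(x),\dots,d_n(x))\geq 0$ for all $x\in\mathbb{R}$; (iii) The set $\{(x,d_1(x),\dots,d_n(x))\mid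 x\in\mathbb{R}\}$ is not dense in $\mathbb{R}^{n+1}$; (iv) $d_1=0$.
   Context: A function $a\colon\mathbb{R}\to\mathbb{R}$ is additive if $a(x+y)=a(x)+a(y)$ for all $x,y\in\mathbb{R}$ (no continuity or $\mathbb{R}$-linearity is assumed). Symmetric means $\Gamma(i,j)=\Gamma(j,i)$ for all $(i,j)\in\Delta_n$. The map $\mathrm{id}$ is the identity $x\mapsto x$. $\mathbb{R}^{n+1}$ carries its usual topology. *)

(* Defs.v *)
From HB Require Import structures.
From mathcomp Require Import all_boot all_order all_algebra.
From mathcomp Require Import all_classical all_reals all_analysis.

Set Implicit Arguments.
Unset Strict Implicit.
Unset Printing Implicit Defensive.

Import Order.TTheory GRing.Theory Num.Theory.
Import numFieldNormedType.Exports.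

Local Open Scope classical_set_scope.
Local Open Scope ring_scope.

(* The library only has [lower_semicontinuous], for functions into [\bar R]. *)
Definition upper_semicontinuous (R : realType) (X : topologicalType)
    (f : X -> R) : Prop :=
  forall x a, f x < a -> \forall y \near x, f y < a.

Lemma upper_semicontinuousN (R : realType) (X : topologicalType) (f : X -> R) :
  upper_semicontinuous f <-> lower_semicontinuous (fun x => (- f x)%:E).
Proof.
split=> usc x a.
  rewrite lte_fin ltrNr => /usc nfx.
  exists [set y | f y < - a] => // y /=.
  by rewrite lte_fin ltrNr.
move=> fx; have /usc[V Vx nV] : ((- a)%:E < (- f x)%:E)%E.
  by rewrite lte_fin ltrN2.
by apply: filterS Vx => y /nV; rewrite lte_fin ltrN2.
Qed.

(* The point (d_0(x), d_1(x), ..., d_n(x)) of R^{n+1}. *)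
Definition joint_value (R : realType) (n : nat) (d : nat -> R -> R) (x : R) :
    'rV[R]_n.+1 :=
  \row_(i < n.+1) d i x.

(* Main.v *)
Require Import Defs.
From HB Require Import structures.
From mathcomp Require Import all_boot all_order all_algebra.
From mathcomp Require Import all_classical all_reals all_analysis.
From mathcomp Require Import zify ring lra.

Set Implicit Arguments.
Unset Strict Implicit.
Unset Printing Implicit Defensive.

Import Order.TTheory GRing.Theory Num.Theory.
Import numFieldNormedType.Exports.

Local Open Scope classical_set_scope.
Local Open Scope ring_scope.

(** The heart of the matter is that a nonzero [d 1] forces [id, d 1, ..., d n] to
    be linearly independent over [R] ([indep_of_d1_neq0]). Take a relation
    [\sum_(i <= k) c i * d i x = 0], evaluate it at [x * y], expand with
    the product rule, and subtract [y] times the relation at [x]. The terms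
    containing [y] itself cancel, so for every fixed [y] a shorter relation in
    [x] remains ([relation_descent]), whose last coefficient is
    [c k * Gamma (k - 1) 1 * d 1 y]. By induction on [k] it vanishes. The
    factor [Gamma (k - 1) 1] is nonzero: the cocycle identity spreads the one
    nonvanishing value on each antidiagonal to this place
    ([cocycle_right1_neq0]). Hence [c k = 0], and the relation was shorter from
    the start.

    Topology enters through the fact that an additive map [f] from [R] to [R^m]
    whose values satisfy no common linear equation has dense range
    ([additive_dense_range]): it takes [m] linearly independent values, and,
    being linear over the rationals, it also takes all their rational
    combinations. Applied to [f = (id, d 1, ..., d n)], this gives (iii) => (iv).

    The other implications are soft. For (i) => (ii) one takes minus the
    absolute value of the linear form given by the relation; for (ii) => (iii),
    the set where [Phi] is negative is open, nonempty, and misses the graph;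
    (iv) is itself a linear relation. *)

(** * Additive maps to a real row space *)

Lemma mulmxr_continuous (R : realType) (m n : nat) (A : 'M[R]_(m, n)) :
  continuous (fun p : 'rV[R]_m => p *m A).
Proof.
move=> p.
rewrite (_ : (fun q => q *m A) = fun q : 'rV_m => \sum_i q 0 i *: row i A);
  last by apply/funext => q; rewrite mulmx_sum_row.
apply: (@cvg_big _ _ _ _ _ add_continuous _ (nbhs p)) => i _.
by apply: cvgZ; [exact: coord_continuous | exact: cvg_cst].
Qed.

Lemma additive_ratrZ (R : numFieldType) (V : lmodType R) (f : {additive R -> V})
    (q : rat) (x : R) :
  f (ratr q * x) = ratr q *: f x.
Proof.
have den0 : (denq q)%:~R != 0 :> R by rewrite intr_eq0 denq_neq0.
have denM : (denq q)%:~R * ratr q = (numq q)%:~R :> R.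
  by rewrite /ratr mulrC mulfVK.
apply: (scalerI den0).
rewrite scalerA denM scaler_int scaler_int -raddfMz -raddfMz.
by congr (f _); rewrite -mulrzl -[RHS]mulrzl mulrA denM.
Qed.

(** If the values of [f] lie in no hyperplane, independent values can be picked
    greedily: fewer than [m] of them span a proper subspace, which cannot
    contain the whole range. *)
Lemma row_free_values (R : fieldType) (T : Type) (m : nat) (f : T -> 'rV[R]_m)
    (f_indep : forall c : 'cV_m, (forall x, f x *m c = 0) -> c = 0) (k : nat) :
  (k <= m)%N ->
  exists2 A : 'M[R]_(k, m), row_free A & forall i, exists x, row i A = f x.
Proof.
elim: k => [_|k IHk ltkm].
  by exists 0 => [|[]//]; rewrite /row_free mxrank0.
have [A A_free A_val] := IHk (ltnW ltkm).
(* Otherwise each column of the cokernel matrix of [A] would be a linear equation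
   for all values of [f]. *)
have [x fxA] : exists x, ~~ (f x <= A)%MS.
  apply: contrapT => /forallNP fA.
  suff : cokermx A = 0.
    move/eqP; rewrite cokermx_eq0 /row_full (eqP A_free) => /eqP km.
    by rewrite km ltnn in ltkm.
  apply/matrixP => i j; rewrite [RHS]mxE.
  suff /matrixP/(_ i 0) : col j (cokermx A) = 0 by rewrite !mxE.
  apply: f_indep => x; rewrite colE mulmxA.
  by have /negP := fA x; rewrite negbK submxE => /eqP ->; rewrite mul0mx.
have rk_col : \rank (col_mx (f x) A) = k.+1.
  apply/eqP; rewrite eqn_leq rank_leq_row -addsmxE -[X in (X < _)%N](eqP A_free).
  rewrite ltn_neqAle mxrankS ?addsmxSr // andbT.
  apply: contra fxA => /eqP rkE; apply: submx_trans (addsmxSl (f x) A) _.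
  by rewrite -(geq_leqif (mxrank_leqif_sup (addsmxSr (f x) A))) -rkE.
(* The block form of the row count is what [split] and [rowKu] match on. *)
rewrite -[k.+1]/(1 + k)%N; exists (col_mx (f x) A); first exact/eqP.
move=> i; rewrite -(splitK i); case: (fintype.split i) => j /=.
  by exists x; rewrite rowKu; apply/rowP => a; rewrite !mxE ord1.
by have [y Ay] := A_val j; exists y; rewrite rowKd.
Qed.

(** The range contains every rational combination of a basis made of values of
    [f], and rational coordinate vectors are dense. *)
Lemma additive_dense_range (R : realType) (m : nat)
    (f : {additive R -> 'rV[R]_m})
    (f_indep : forall c : 'cV_m, (forall x, f x *m c = 0) -> c = 0) :
  dense (range f).
Proof.
have [A A_free A_val] := row_free_values f_indep (leqnn m).
have A_unit : A \in unitmx by rewrite -row_free_unit.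
move=> U [p Up] oU.
(* In coordinates with respect to the rows of [A], a whole ball around those of
   [p] is mapped into [U]. *)
have [e /= e0 Ue] : nbhs_ball (p *m invmx A) [set w | U (w *m A)].
  apply/nbhs_ballP; apply: mulmxr_continuous => /=.
  by rewrite mulmxKV //; exact: open_nbhs_nbhs.
have /choice[q wq] : forall i, exists q : rat,
    ratr q \in `](p *m invmx A) 0 i - e, (p *m invmx A) 0 i + e[.
  by move=> i; apply: rat_in_itvoo; rewrite ltrD2l gtrN.
have [x Ax] := choice A_val.
exists (f (\sum_i ratr (q i) * x i)); split;
  last by exists (\sum_i ratr (q i) * x i).
rewrite raddf_sum.
have -> : \sum_i f (ratr (q i) * x i) = (\row_i ratr (q i)) *m A.
  rewrite mulmx_sum_row; apply: eq_bigr => i _.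
  by rewrite additive_ratrZ -Ax mxE.
apply: Ue; split=> // i j; rewrite ord1 [X in ball _ _ X]mxE.
have := wq j; rewrite in_itv /= => /andP[lo hi].
by rewrite /ball /= ltr_norml; apply/andP; split; lra.
Qed.

(** * Independence of the components of a twisted higher derivation *)

(** Given [Gamma i (k - i) <> 0] with [0 < i < k], the cocycle identity for the
    triple [(i, k - i - 1, 1)] reads
    [Gamma (k - 1) 1 * Gamma i (k - i - 1)
       = Gamma i (k - i) * Gamma (k - i - 1) 1],
    and its right-hand side is nonzero by induction on [k]. *)
Lemma cocycle_right1_neq0 (R : idomainType) (n : nat) (Gamma : nat -> nat -> R)
    (Gamma_01 : (0 < n)%N -> Gamma 0%N 1%N = 1)
    (Gamma_cocycle : forall i j k : nat, (i + j + k <= n)%N ->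
       Gamma (i + j)%N k * Gamma i j = Gamma i (j + k)%N * Gamma j k)
    (Gamma_neq0 : forall k : nat, (2 <= k <= n)%N ->
       exists i : nat, (1 <= i <= k - 1)%N /\ Gamma i (k - i)%N <> 0)
    (k : nat) :
  (k < n)%N -> Gamma k 1%N != 0.
Proof.
elim/ltn_ind: k => -[_ n0|k IHk kn]; first by rewrite Gamma_01 // oner_neq0.
have [i [/andP[i0 ik] /eqP Gi]] := Gamma_neq0 k.+2 kn.
have Gj : Gamma (k.+1 - i)%N 1%N != 0 by apply: IHk; lia.
have := Gamma_cocycle i (k.+1 - i)%N 1%N.
have -> : (i + (k.+1 - i) = k.+1)%N by lia.
have -> : (k.+1 - i + 1 = k.+2 - i)%N by lia.
rewrite addn1 => /(_ kn) E.
have := mulf_neq0 Gi Gj; rewrite -E.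
by apply: contra => /eqP ->; rewrite mul0r.
Qed.

(** The difference between the relation at [x * y] and [y] times the relation at
    [x]. Expanding [d i (x * y)] and collecting the multiples of [d j x], the
    term [i = j] contributes [c j * y], which the subtraction removes; for
    [j = k] nothing else is there, so the new relation is shorter. *)
Lemma relation_descent (R : comNzRingType) (Gamma : nat -> nat -> R)
    (d : nat -> R -> R) (k : nat)
    (Gamma_r0 : forall j : nat, (j <= k)%N -> Gamma j 0%N = 1)
    (d_0 : d 0%N = id)
    (d_product : forall i : nat, (i <= k)%N -> forall x y : R,
       d i (x * y) =
         \sum_(0 <= j < i.+1) Gamma j (i - j)%N * d j x * d (i - j)%N y)
    (c : nat -> R) (rel : forall x, \sum_(0 <= i < k.+1) c i * d i x = 0)
    (x y : R) :
  \sum_(0 <= j < k)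
    (\sum_(j.+1 <= i < k.+1) c i * Gamma j (i - j)%N * d (i - j)%N y) * d j x
  = 0.
Proof.
pose g j i := c i * Gamma j (i - j)%N * d (i - j)%N y.
have relM : \sum_(0 <= j < k.+1) (\sum_(j <= i < k.+1) g j i) * d j x = 0.
  apply: etrans (rel (x * y)).
  transitivity (\sum_(0 <= i < k.+1) \sum_(0 <= j < k.+1 | (j < i.+1)%N)
                  g j i * d j x).
    rewrite (exchange_big_dep_nat xpredT) //=; apply: eq_bigr => j _.
    by rewrite (big_nat_widenl j 0) // mulr_suml.
  apply: eq_big_nat => i /andP[_ ik].
  rewrite -(big_nat_widen 0 i.+1 k.+1 xpredT) // d_product // mulr_sumr.
  by apply: eq_bigr => j _; rewrite /g; ring.
have relY : \sum_(0 <= j < k.+1) y * (c j * d j x) = 0.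
  by rewrite -mulr_sumr rel mulr0.
have : \sum_(0 <= j < k.+1)
    ((\sum_(j <= i < k.+1) g j i) * d j x - y * (c j * d j x)) = 0.
  by rewrite sumrB relM relY subrr.
rewrite big_nat_recr //= big_nat1.
rewrite {2}/g subnn d_0 Gamma_r0 // mulr1.
have -> : c k * y * d k x - y * (c k * d k x) = 0 by ring.
rewrite addr0; apply: etrans; apply: eq_big_nat => j /andP[_ jk].
rewrite [in RHS](@big_ltn _ _ _ j) ?ltnS 1?ltnW // {1}/g subnn d_0.
rewrite Gamma_r0 1?ltnW //=.
by rewrite mulr1 /g; ring.
Qed.

(** Induction on the length of the relation: the descended relation has last
    coefficient [c k.+1 * Gamma k 1 * d 1 y], so the top coefficient [c k.+1]
    vanishes and the original relation is itself shorter. *)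
Lemma indep_of_d1_neq0 (R : idomainType) (n : nat) (Gamma : nat -> nat -> R)
    (d : nat -> R -> R)
    (Gamma_r0 : forall j : nat, (j <= n)%N -> Gamma j 0%N = 1)
    (Gamma_r1 : forall j : nat, (j < n)%N -> Gamma j 1%N != 0)
    (d_0 : d 0%N = id)
    (d_product : forall i : nat, (i <= n)%N -> forall x y : R,
       d i (x * y) =
         \sum_(0 <= j < i.+1) Gamma j (i - j)%N * d j x * d (i - j)%N y)
    (y : R) (d1y : d 1%N y != 0) (k : nat) (c : nat -> R) :
  (k <= n)%N -> (forall x, \sum_(0 <= i < k.+1) c i * d i x = 0) ->
  forall i, (i <= k)%N -> c i = 0.
Proof.
elim: k c => [|k IHk] c kn rel i.
  by rewrite leqn0 => /eqP ->; have := rel 1; rewrite big_nat1 d_0 mulr1.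
have ck0 : c k.+1 = 0.
  have := IHk (fun j => \sum_(j.+1 <= i < k.+2)
    c i * Gamma j (i - j)%N * d (i - j)%N y) (ltnW kn) _ k (leqnn k).
  rewrite /= big_nat1 subSnn => top0.
  have /eqP : c k.+1 * Gamma k 1%N * d 1%N y = 0.
    apply: top0 => x; apply: (@relation_descent _ Gamma) => //.
    - by move=> j jk; apply/Gamma_r0/(leq_trans jk).
    - by move=> j jk; apply/d_product/(leq_trans jk).
  by rewrite !mulf_eq0 (negPf d1y) (negPf (Gamma_r1 k kn)) !orbF => /eqP.
rewrite leq_eqVlt ltnS => /predU1P[-> //|ik].
apply: IHk ik; first exact: ltnW.
by move=> x; have := rel x; rewrite big_nat_recr //= ck0 mul0r addr0.
Qed.

(** * Linear relations, semicontinuous inequalities and density *)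

Lemma usc_nonneg_on_not_dense (R : realType) (X : topologicalType)
    (Phi : X -> R) (S : set X) :
  upper_semicontinuous Phi -> (exists p, Phi p < 0) ->
  (forall p, S p -> 0 <= Phi p) -> ~ dense S.
Proof.
move=> usc [p Phip] Phi_ge0 /(_ [set q | Phi q < 0]).
case; first by exists p.
  by rewrite openE => q; exact: usc.
by move=> q [/= Phiq /Phi_ge0]; rewrite leNgt Phiq.
Qed.

Lemma continuous_usc (R : realType) (X : topologicalType) (f : X -> R) :
  continuous f -> upper_semicontinuous f.
Proof. by move=> f_cont x a fx; exact: (cvgr_lt _ (f_cont x)). Qed.

Theorem theorem8 (R : realType) (n : nat) (Gamma : nat -> nat -> R)
    (d : nat -> R -> R)
    (n_ge1 : (1 <= n)%N)
    (Gamma_sym : forall i j : nat, (i + j <= n)%N -> Gamma i j = Gamma j i)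
    (Gamma_1 : forall i j : nat, (i + j <= n)%N -> (i * j = 0)%N ->
       Gamma i j = 1)
    (Gamma_cocycle : forall i j k : nat, (i + j + k <= n)%N ->
       Gamma (i + j)%N k * Gamma i j = Gamma i (j + k)%N * Gamma j k)
    (Gamma_neq0 : forall k : nat, (2 <= k <= n)%N ->
       exists i : nat, (1 <= i <= k - 1)%N /\ Gamma i (k - i)%N <> 0)
    (d_0 : d 0%N = id)
    (d_additive : forall k : nat, (1 <= k <= n)%N ->
       forall x y : R, d k (x + y) = d k x + d k y)
    (d_product : forall k : nat, (1 <= k <= n)%N -> forall x y : R,
       d k (x * y) =
         \sum_(0 <= i < k.+1) Gamma i (k - i)%N * d i x * d (k - i)%N y) :
  [<-> (* (i) *)
       exists c : nat -> R,
         0 < \sum_(0 <= i < n.+1) c i ^+ 2 /\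
         forall x : R, c 0%N * x + \sum_(1 <= i < n.+1) c i * d i x = 0;
       (* (ii) *)
       exists Phi : 'rV[R]_n.+1 -> R,
         [/\ upper_semicontinuous Phi,
             exists p : 'rV[R]_n.+1, Phi p < 0 &
             forall x : R, 0 <= Phi (joint_value n d x)];
       (* (iii) *)
       ~ dense [set joint_value n d x | x in [set: R]];
       (* (iv) *)
       forall x : R, d 1%N x = 0].
Proof.
tfae.
- move=> [c [c_gt0 rel]].
  (* The relation says that the linear form [p |-> p *m v] vanishes on the graph,
     and it is positive at the point [v^T], where it is the sum of squares. *)
  pose v : 'cV[R]_n.+1 := \col_i c i.
  have v_rel x : joint_value n d x *m v = 0.
    apply/matrixP => a b; rewrite !mxE -[RHS](rel x).
    rewrite (eq_bigr (fun i : 'I_n.+1 => c i * d i x)).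
      by rewrite -(big_mkord xpredT (fun i => c i * d i x)) big_ltn // d_0.
    by move=> i _; rewrite !mxE mulrC.
  exists (fun p => - `|(p *m v) 0 0|); split.
  - apply: continuous_usc => p.
    have vp : (q *m v) 0 0 @[q --> p] --> (p *m v) 0 0.
      by apply: (cvg_comp (mulmx^~ v) (fun M : 'M[R]_1 => M 0 0));
        [exact: mulmxr_continuous | exact: coord_continuous].
    exact: cvgN (cvg_norm vp).
  - exists v^T; rewrite oppr_lt0 normr_gt0 gt_eqF // mxE.
    rewrite (eq_bigr (fun i : 'I_n.+1 => c i ^+ 2)); last first.
      by move=> i _; rewrite !mxE expr2.
    by rewrite -(big_mkord xpredT (fun i => c i ^+ 2)).
  - by move=> x; rewrite v_rel mxE normr0 oppr0.
- move=> [Phi [Phi_usc Phi_neg Phi_ge0]].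
  by apply: usc_nonneg_on_not_dense Phi_usc Phi_neg _ => _ [x _ <-].
- move=> not_dense; apply: contrapT => /existsNP[y /eqP d1y].
  apply: not_dense.
  have Gamma_r1 := cocycle_right1_neq0 (fun n0 => Gamma_1 0%N 1%N n0 erefl)
    Gamma_cocycle Gamma_neq0.
  have Gamma_r0 j : (j <= n)%N -> Gamma j 0%N = 1.
    by move=> jn; rewrite Gamma_1 ?addn0 ?muln0.
  have d_prod k : (k <= n)%N -> forall x z, d k (x * z) =
      \sum_(0 <= i < k.+1) Gamma i (k - i)%N * d i x * d (k - i)%N z.
    case: k => [_ x z|k kn]; last exact: d_product.
    by rewrite big_nat1 d_0 Gamma_r0 // mul1r.
  have d_add k : (k <= n)%N -> {morph d k : x z / x + z}.
    by case: k => [_ x z|k kn]; [rewrite d_0 | exact: d_additive].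
  have joint_add : zmod_morphism (joint_value n d).
    move=> x z; apply/rowP => i; rewrite !mxE; apply/eqP.
    by rewrite eq_sym subr_eq -d_add ?subrK // -ltnS.
  pose f : {additive R -> 'rV[R]_n.+1} := HB.pack (joint_value n d)
    (GRing.isZmodMorphism.Build R 'rV[R]_n.+1 (joint_value n d) joint_add).
  apply: (additive_dense_range (f := f)) => c rel.
  apply/colP => i; rewrite mxE -[i]inord_val.
  apply: (indep_of_d1_neq0 (c := fun j => c (inord j) 0) Gamma_r0 Gamma_r1 d_0
    d_prod d1y (leqnn n)); last by rewrite -ltnS.
  move=> x; rewrite big_mkord.
  have /matrixP/(_ 0 0) := rel x; rewrite !mxE => fx0.
  apply: etrans fx0; apply: eq_bigr => j _.
  by rewrite inord_val /f /= mxE mulrC.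
- move=> d1; exists (fun i => (i == 1%N)%:R); split.
    rewrite big_mkord (bigD1 (Ordinal (n_ge1 : (1 < n.+1)%N))) //=.
    by rewrite expr1n ltr_pwDl // sumr_ge0 // => i _; rewrite sqr_ge0.
  move=> x; rewrite mul0r add0r big_ltn // mul1r d1 add0r.
  rewrite big_nat_cond big1 // => i /andP[/andP[i1 _] _].
  by rewrite gtn_eqF ?mul0r.
Qed.
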